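(* Let $a,b,c,d,\alpha,\beta$ be real constants such that $$\alpha,\beta>0\quad\text{and}\quad bc\ge1\ge a>0,\ d>0,$$ and let $\boldsymbol{A}=\{A_0,A_1\}\subset\mathbb{R}^{2\times2}$, where $$A_0=\alpha\begin{pmatrix}a&b\\0&1\end{pmatrix},\qquad A_1=\beta\begin{pmatrix}1&0\\c&d\end{pmatrix}.$$ Then $\boldsymbol{A}$ has the spectral finiteness if and only if its switching frequency $\sigma(\boldsymbol{A})$ is rational.
   Context: $\rho(M)$ is the usual spectral radius of a real square matrix $M$. For a finite set $\boldsymbol{A}$ of real square matrices of the same size and $n\ge1$, let $\boldsymbol{A}^n=\{M_1\cdots M_n : M_i\in\boldsymbol{A},\ 1\le i\le n\}$. The generalized spectral radius of $\boldsymbol{A}$ is $$\boldsymbol{\rho}(\boldsymbol{A})=\sup_{n\ge1}\max_{M\in\boldsymbol{A}^n}\rho(M)^{1/n}.$$ $\boldsymbol{A}$ has the spectral finiteness if there exist $n\ge1$ and $M\in\boldsymbol{A}^{n}$ with $\boldsymbol{\rho}(\boldsymbol{A})=\rho(M)^{1/n}$. Switching frequency. Let $\boldsymbol{A}=\{A_0,A_1\}$ be as in the claim and write $\boldsymbol{\rho}=\boldsymbol{\rho}(\boldsymbol{A})$. By a result of Barabanov there exists a Barabanov norm for $\boldsymbol{A}$, i.e. a norm $|||\cdot|||$ on $\mathbb{R}^2$ such that $$\boldsymbol{\rho}\,|||x|||=\max\{|||A_0x|||,\ |||A_1x|||\}\quad\forall x\in\mathbb{R}^2 .$$ Fix such a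 norm. For any $x_0\in\mathbb{R}^2\setminus\{0\}$ there is then a (B-extremal) switching law for $x_0$, i.e. a map $n\mapsto\mathfrak{i}_n(x_0)$ from $\{1,2,\dotsc\}$ to $\{0,1\}$ such that $$|||A_{\mathfrak{i}_n(x_0)}\cdots A_{\mathfrak{i}_1(x_0)}x_0|||=\boldsymbol{\rho}^n\,|||x_0|||\quad\forall n\ge1.$$ By a theorem of Kozyakin (Structure of extremal trajectories of discrete linear systems and the finiteness conjecture, 2007, Theorem 6), the limit $$\sigma(\boldsymbol{A}):=\lim_{n\to\infty}\frac1n\sum_{k=1}^n\mathfrak{i}_k(x_0)$$ exists and does not depend on the choice of $x_0\in\mathbb{R}^2\setminus\{0\}$ or of the B-extremal switching law for $x_0$. The number $\sigma(\boldsymbol{A})$ is called the switching frequency of $\boldsymbol{A}$. *)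

(* Defs.v *)
From HB Require Import structures.
From mathcomp Require Import all_boot all_order all_algebra.
From mathcomp Require Import all_classical all_reals all_analysis.
From mathcomp Require Import complex.
Import Order.TTheory GRing.Theory Num.Theory.
Import numFieldNormedType.Exports.

Set Implicit Arguments.
Unset Strict Implicit.
Unset Printing Implicit Defensive.

Local Open Scope classical_set_scope.
Local Open Scope ring_scope.

(* The eigenvalues are the complex ones; [normc] is the modulus, with values
   in [R]. There are finitely many eigenvalues, so that this [sup] is a maximum
   as soon as [0 < m]. *)
Definition spectral_radius (R : realType) (m : nat) (M : 'M[R]_m) : R :=
  sup [set Normc.normc z |
        z in [set z : R[i] | eigenvalue (map_mx (real_complex R) M) z]].

Definition mx_products (R : realType) (m : nat) (A : set 'M[R]_m) (n : nat) :
    set 'M[R]_m :=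
  [set \prod_(k < n) M k | M in [set M : 'I_n -> 'M[R]_m | forall k, A (M k)]].

(* Meant for a nonempty finite [A]: [mx_products A n] is then nonempty and
   finite, and the inner [sup] is a maximum. *)
Definition generalized_spectral_radius (R : realType) (m : nat)
    (A : set 'M[R]_m) : R :=
  sup [set sup [set spectral_radius M `^ n%:R^-1 | M in mx_products A n] |
        n in [set n : nat | (1 <= n)%N]].

Definition spectral_finiteness (R : realType) (m : nat) (A : set 'M[R]_m) :
    Prop :=
  exists n : nat, (1 <= n)%N /\
    exists2 M : 'M[R]_m, mx_products A n M &
      generalized_spectral_radius A = spectral_radius M `^ n%:R^-1.

(* Nonnegativity and [N 0 = 0] follow from these axioms. *)
Record is_norm (R : realType) (m : nat) (N : 'cV[R]_m -> R) : Prop := IsNorm {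
  is_norm_triangle : forall x y, N (x + y) <= N x + N y ;
  is_norm_scale : forall (t : R) x, N (t *: x) = `|t| * N x ;
  is_norm_definite : forall x, N x = 0 -> x = 0
}.

Section SwitchingFrequency.
Variables (R : realType) (m : nat) (A0 A1 : 'M[R]_m).

Let rho : R := generalized_spectral_radius [set A0; A1].

Definition Barabanov_norm (N : 'cV[R]_m -> R) : Prop :=
  is_norm N /\
  forall x : 'cV[R]_m, rho * N x = Num.max (N (A0 *m x)) (N (A1 *m x)).

(* A switching law is indexed by the positive integers: [i 0] is never used.
   Its values [false] and [true] stand for 0 and 1. *)
Fixpoint switched_product (i : nat -> bool) (n : nat) : 'M[R]_m :=
  if n is k.+1 then (if i k.+1 then A1 else A0) *m switched_product i k
  else 1%:M.

Definition extremal_law (N : 'cV[R]_m -> R) (x0 : 'cV[R]_m)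
    (i : nat -> bool) : Prop :=
  forall n : nat, (1 <= n)%N -> N (switched_product i n *m x0) = rho ^+ n * N x0.

(* [s] is the common limit of the frequencies of the symbol 1 along all the
   extremal laws, for all the nonzero initial vectors. Every nonzero [x0] has
   an extremal law when [N] is a Barabanov norm, whence the uniqueness of [s]
   (for [0 < m]). *)
Definition is_switching_frequency (N : 'cV[R]_m -> R) (s : R) : Prop :=
  forall (x0 : 'cV[R]_m) (i : nat -> bool), x0 != 0 -> extremal_law N x0 i ->
    (n%:R^-1 * \sum_(1 <= k < n.+1) (i k)%:R : R) @[n --> \oo] --> s.

End SwitchingFrequency.

Definition mx22 (R : realType) (p q r s : R) : 'M[R]_2 :=
  \matrix_(i < 2, j < 2)
    if i == 0 then (if j == 0 then p else q) else (if j == 0 then r else s).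

(* Main.v *)
Require Import Defs.
From mathcomp Require Import all_boot all_order all_algebra.
From mathcomp Require Import all_classical all_reals all_analysis.
From mathcomp Require Import complex ring lra zify.
Import Order.TTheory GRing.Theory Num.Theory.
Import numFieldNormedType.Exports.

Set Implicit Arguments.
Unset Strict Implicit.
Unset Printing Implicit Defensive.

Local Open Scope classical_set_scope.
Local Open Scope ring_scope.

(* Up to conjugation by [diag(1, sgn b)] one has [b, c > 0], so that all the
   products are nonnegative and have real eigenvalues. If a product [M] of
   length [n] realizes the generalized spectral radius, repeating it along a
   leading eigenvector is an extremal law, and the switching frequency is the
   frequency of [A1] in [M].

   Conversely, the Barabanov norm is monotone on the quadrant: along an
   extremal trajectory the determinant of two vectors decays faster than the
   squared norm, because [det A0] and [det A1] are smaller than the square of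
   the generalized spectral radius. Monotonicity then forces [A0] to be
   extremal for the small slopes [x / y] and [A1] for the large ones. As [bc >= 1], the
   images of the quadrant by [A0] and [A1] do not overlap, and the induced map
   on slopes is an order preserving circle map whose rotation number is the
   switching frequency. When this number is rational, a lifted orbit is
   monotone along the multiples of the period, so that the word becomes
   periodic and the slopes converge to an eigendirection of its product. *)

(** * Rotation numbers of orbits of order preserving circle maps *)

Section Rotation.
Variable R : realType.

Definition count_true (t : nat -> bool) (n : nat) : nat := (\sum_(k < n) t k)%N.

Lemma count_trueS t n : count_true t n.+1 = (count_true t n + t n)%N.
Proof. by rewrite /count_true big_ord_recr. Qed.

Lemma count_true_le t n : (count_true t n <= n)%N.
Proof.
elim: n => [|n IH]; first by rewrite /count_true big_ord0.
by rewrite count_trueS; case: (t n); lia.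
Qed.

Lemma count_true_negb t n : (count_true (fun k => ~~ t k) n + count_true t n = n)%N.
Proof.
elim: n => [|n IH]; first by rewrite /count_true !big_ord0.
by rewrite !count_trueS; case: (t n) => /=; lia.
Qed.

(** An orbit of an order preserving circle map of degree one, seen in [(0, 1)]. The letter 1 marks
    the upper positions, where the map wraps around; the last condition puts the image of the upper
    branch below that of the lower one, so that the lift is nondecreasing. *)
Definition monotone_orbit (t : nat -> bool) (u : nat -> R) : Prop :=
  [/\ forall k, 0 < u k < 1,
      forall j k, u j <= u k -> t j -> t k,
      forall j k, t j = t k -> u j <= u k -> u j.+1 <= u k.+1 &
      forall j k, t j -> ~~ t k -> u j.+1 <= u k.+1].

(** The reflection [x -> 1 - x] swaps the letters; it serves to reduce downward displacements to
    upward ones. *)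
Lemma monotone_orbit_negb t u : monotone_orbit t u ->
  monotone_orbit (fun k => ~~ t k) (fun k => 1 - u k).
Proof.
case=> u01 tle ueq ulast; split=> [k|j k ujk|j k tjk ujk|j k tj tk].
- by have /andP[? ?] := u01 k; apply/andP; split; lra.
- by apply: contra; apply: tle; lra.
- have : u k.+1 <= u j.+1 by apply: ueq; [case: (t j) (t k) tjk => [] []|lra].
  lra.
- have : u k.+1 <= u j.+1 by apply: ulast => //; rewrite -(negbK (t k)).
  lra.
Qed.

(** The trajectory of the lift to the real line: each letter 1 counts one full turn. *)
Definition orbit_lift (t : nat -> bool) (u : nat -> R) n := (count_true t n)%:R + u n.

Lemma lift_negb t u n :
  orbit_lift (fun k => ~~ t k) (fun k => 1 - u k) n = n%:R + 1 - orbit_lift t u n.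
Proof.
by rewrite /orbit_lift -[X in X%:R + 1 - _](count_true_negb t n) natrD; ring.
Qed.

Lemma int_gtN1_ge0 (z : int) : -1 < z%:~R :> R -> 0 <= z.
Proof. by rewrite -[-1]/((-1 : int)%:~R) ltr_int; lia. Qed.

(** The integer gap [y] between the turns is nonnegative, since positions lie in [(0, 1)]. For
    [y = 0] the branches decide; for [y = 1] only an upper position against a lower one needs an
    argument; from [y = 2] on the slack suffices. *)
Lemma lift_monotone_step t u j k (z : int) : monotone_orbit t u ->
  orbit_lift t u j <= orbit_lift t u k + z%:~R ->
  orbit_lift t u j.+1 <= orbit_lift t u k.+1 + z%:~R.
Proof.
case=> u01 tle ueq ulast; rewrite /orbit_lift !count_trueS !natrD => h.
have /andP[uj0 uj1] := u01 j; have /andP[uk0 uk1] := u01 k.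
have /andP[vj0 vj1] := u01 j.+1; have /andP[vk0 vk1] := u01 k.+1.
pose y : int := (count_true t k)%:Z + z - (count_true t j)%:Z.
have yE : y%:~R = (count_true t k)%:R + z%:~R - (count_true t j)%:R :> R.
  by rewrite /y rmorphB rmorphD.
have y0 : 0 <= y by apply: int_gtN1_ge0; rewrite yE; lra.
move: yE; case: y y0 => // -[|[|y]] _ /= yE.
- have := tle j k; have := ueq j k; case: (t j) (t k) => [] [] /= U T.
  + have : u j.+1 <= u k.+1 by apply: U => //; lra.
    lra.
  + by have : false by apply: T => //; lra.
  + lra.
  + have : u j.+1 <= u k.+1 by apply: U => //; lra.
    lra.
- have := ulast j k; case: (t j) (t k) => [] [] /= U; lra.
- have y2 : (2 : R) <= (Posz y.+2)%:~R by rewrite (ler_nat R 2 y.+2).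
  case: (t j) (t k) => [] [] /=; lra.
Qed.

Lemma lift_monotone t u j k (z : int) n : monotone_orbit t u ->
  orbit_lift t u j <= orbit_lift t u k + z%:~R ->
  orbit_lift t u (j + n) <= orbit_lift t u (k + n) + z%:~R.
Proof.
by move=> tu h; elim: n => [|n IH]; rewrite ?addn0 // !addnS; apply: lift_monotone_step.
Qed.

(** By monotonicity a gain of [z] in [r] steps repeats, giving at least [j * z] in [j * r] steps,
    while [s] is the mean number of turns per step. *)
Lemma lift_displacement_ge t u (s : R) r (z : int) : monotone_orbit t u ->
  (n%:R^-1 * (count_true t n)%:R) @[n --> \oo] --> s ->
  orbit_lift t u 0 + z%:~R <= orbit_lift t u r -> z%:~R <= s * r%:R.
Proof.
move=> tu cv h; rewrite leNgt; apply/negP => sz.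
have iter j : orbit_lift t u 0 + j%:R * z%:~R <= orbit_lift t u (j * r).
  elim: j => [|j IH]; first by rewrite mul0r addr0.
  have : orbit_lift t u (0 + j * r) <= orbit_lift t u (r + j * r) + (- z)%:~R.
    by apply: lift_monotone => //; rewrite rmorphN /=; lra.
  rewrite rmorphN /= add0n mulSn -natr1 => h'; lra.
case: r => [|r] in h sz iter *.
  by rewrite mulr0 in sz; lra.
have r0 : 0 < r.+1%:R :> R by rewrite ltr0n.
set e := z%:~R - s * r.+1%:R.
have e0 : 0 < e by rewrite subr_gt0.
have [N _ hN] : \forall n \near \oo,
    n%:R^-1 * (count_true t n)%:R < s + e / (2 * r.+1%:R).
  by apply: (cvgr_lt s cv); rewrite ltrDl divr_gt0 // mulr_gt0.
(* Half of [e] is spent on the convergence; [j] makes the other half, [j * e / 2], exceed the error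
   below 1 that comes from the positions. *)
pose j := maxn N.+1 (Num.bound (2 / e)).
have j0 : 0 < j%:R :> R by rewrite ltr0n /j; lia.
have je : 2 < j%:R * e.
  rewrite -ltr_pdivrMr //; apply: lt_le_trans (archi_boundP _) _.
    by rewrite divr_ge0 // ltW.
  by rewrite ler_nat leq_maxr.
have := hN (j * r.+1)%N; rewrite /= => /(_ _).
have Nj : (N <= j * r.+1)%N by rewrite /j; nia.
move=> /(_ Nj); rewrite ltr_pdivrMl ?natrM ?mulr_gt0 //.
have -> : j%:R * r.+1%:R * (s + e / (2 * r.+1%:R)) = j%:R * (s * r.+1%:R) + j%:R * e / 2.
  by field; rewrite gt_eqF.
have := iter j; rewrite /orbit_lift.
have [u01 _ _ _] := tu; have /andP[? ?] := u01 0%N; have /andP[? ?] := u01 (j * r.+1)%N.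
have : j%:R * z%:~R = j%:R * (s * r.+1%:R) + j%:R * e by rewrite /e; ring.
rewrite {1}/count_true big_ord0; lra.
Qed.

Lemma frequency_negb t (s : R) :
  (n%:R^-1 * (count_true t n)%:R) @[n --> \oo] --> s ->
  (n%:R^-1 * (count_true (fun k => ~~ t k) n)%:R) @[n --> \oo] --> 1 - s.
Proof.
move=> cv.
have h : (1 - n%:R^-1 * (count_true t n)%:R) @[n --> \oo] --> 1 - s.
  by apply: cvgB => //; exact: cvg_cst.
apply: cvg_trans h; apply: near_eq_cvg; near=> n.
have n0 : n%:R != 0 :> R by rewrite pnatr_eq0 -lt0n; near: n; exact: nbhs_infty_gt.
have e : n%:R = (count_true (fun k => ~~ t k) n)%:R + (count_true t n)%:R :> R.
  by rewrite -natrD count_true_negb.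
rewrite (_ : (count_true (fun k => ~~ t k) n)%:R = n%:R - (count_true t n)%:R); last first.
  by rewrite e; ring.
by rewrite mulrBr mulVf.
Unshelve. all: by end_near.
Qed.

(** One unit is lost to the floor of the displacement and one to the positions in [(0, 1)], whence a
    bound uniform in [n]. *)
Lemma count_true_le_frequency t u (s : R) n : monotone_orbit t u ->
  (n%:R^-1 * (count_true t n)%:R) @[n --> \oo] --> s ->
  (count_true t n)%:R <= s * n%:R + 2.
Proof.
move=> tu cv; set z := Num.floor (orbit_lift t u n - orbit_lift t u 0).
have zle : z%:~R <= orbit_lift t u n - orbit_lift t u 0 by exact: Num.Theory.floor_le.
have zgt : orbit_lift t u n - orbit_lift t u 0 < z%:~R + 1.
  by have := Num.Theory.floorD1_gt (orbit_lift t u n - orbit_lift t u 0); rewrite intrD1.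
have := @lift_displacement_ge t u s n z tu cv.
have [u01 _ _ _] := tu; have /andP[? ?] := u01 0%N; have /andP[? ?] := u01 n.
move=> H; have {}H : z%:~R <= s * n%:R by apply: H; lra.
by move: zgt; rewrite /orbit_lift {2}/count_true big_ord0; lra.
Qed.

(* The excesses [count_true t (k + q) - count_true t k - m] are nonnegative integers, and their
   sum telescopes to a bounded quantity. *)
Lemma count_true_eventually_periodic t u (s : R) m q : monotone_orbit t u ->
  (n%:R^-1 * (count_true t n)%:R) @[n --> \oo] --> s ->
  s * q%:R = m%:R -> orbit_lift t u 0 + m%:R <= orbit_lift t u q ->
  exists K, forall k, (K <= k)%N -> count_true t (k + q) = (count_true t k + m)%N.
Proof.
move=> tu cv smq h.
have [u01 _ _ _] := tu.
have ge k : (count_true t k + m <= count_true t (k + q))%N.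
  have : orbit_lift t u (0 + k) <= orbit_lift t u (q + k) + (- m%:Z)%:~R.
    by apply: lift_monotone => //; rewrite rmorphN /=; lra.
  rewrite add0n rmorphN /= addnC /orbit_lift.
  have /andP[? ?] := u01 k; have /andP[? ?] := u01 (k + q)%N => h'.
  rewrite -ltnS -(ltr_nat R) -natr1 natrD; lra.
pose E n := (\sum_(k < n) (count_true t (k + q) - count_true t k - m))%N.
have ES n : E n.+1 = (E n + (count_true t (n + q) - count_true t n - m))%N.
  by rewrite /E big_ord_recr.
have Etel n : (E n + n * m + \sum_(r < q) count_true t r = \sum_(r < q) count_true t (n + r))%N.
  elim: n => [|n IH]; first by rewrite /E big_ord0.
  have sh : (\sum_(r < q) count_true t (n.+1 + r) + count_true t n
             = \sum_(r < q) count_true t (n + r) + count_true t (n + q))%N.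
    transitivity (\sum_(r < q.+1) count_true t (n + r))%N; last by rewrite big_ord_recr.
    rewrite big_ord_recl /= addn0 addnC; congr addn.
    by apply: eq_bigr => r _; rewrite /bump /= addnCA addSn.
  rewrite ES; have := ge n; lia.
(* Each count in the window is at most [s * (n + q) + 2]; as [s * q = m], the part growing with [n]
   cancels against [n * m]. *)
have Ebnd n : (E n <= q * m + 2 * q)%N.
  have q0 : 0 <= q%:R :> R by [].
  rewrite -(ler_nat R) natrD !natrM.
  have : (\sum_(r < q) count_true t (n + r))%:R <= \sum_(r < q) (s * (n + q)%:R + 2) :> R.
    rewrite natr_sum; apply: ler_sum => r _.
    apply: le_trans (count_true_le_frequency (n + r) tu cv) _.
    rewrite lerD2r ler_wpM2l ?ler_nat ?leq_add2l 1?ltnW //.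
    have q_gt0 : 0 < q%:R :> R by rewrite ltr0n (leq_ltn_trans _ (ltn_ord r)).
    by rewrite -(pmulr_lge0 _ q_gt0) smq.
  rewrite -Etel !natrD natrM sumr_const card_ord -mulr_natl.
  have : 0 <= (\sum_(r < q) count_true t r)%:R :> R by [].
  have : (s * q%:R) * (n%:R + q%:R) = m%:R * (n%:R + q%:R) by rewrite smq.
  lra.
(* The nondecreasing bounded sum [E] reaches its maximum at [N], after which every excess
   vanishes. *)
have [N hN] : exists N, forall n, (E n <= E N)%N.
  have exE : exists v, `[< exists n, E n = v >] by exists (E 0%N); apply/asboolP; exists 0%N.
  have ubE v : `[< exists n, E n = v >] -> (v <= q * m + 2 * q)%N.
    by move=> /asboolP[n <-]; exact: Ebnd.
  case: (ex_maxnP exE ubE) => v /asboolP[N <-] Nmax.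
  by exists N => n; apply: Nmax; apply/asboolP; exists n.
have Emono i j : (i <= j)%N -> (E i <= E j)%N.
  by move=> /subnK <-; elim: (j - i)%N => // n IH; rewrite addSn ES; lia.
exists N => k Nk; have := hN k.+1; have := Emono _ _ Nk; have := ge k.
rewrite ES; lia.
Qed.

(** Once all windows of length [q] contain [m] letters 1, the letter leaving a shifted window equals
    the one entering. The lift inequality then reduces to [u k <= u (k + q)], and a bounded monotone
    sequence converges. *)
Lemma rational_rotation_up t u (s : R) m q : monotone_orbit t u ->
  (n%:R^-1 * (count_true t n)%:R) @[n --> \oo] --> s ->
  s * q%:R = m%:R -> orbit_lift t u 0 + m%:R <= orbit_lift t u q ->
  exists K l, (forall k, (K <= k)%N -> t (k + q)%N = t k) /\
    u (K + j * q)%N @[j --> \oo] --> (l : R).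
Proof.
move=> tu cv smq h.
have [u01 _ _ _] := tu.
have [K HK] := count_true_eventually_periodic tu cv smq h.
exists K, (limn (fun j => u (K + j * q)%N)); split=> [k Kk|].
  have := HK k Kk; have := HK k.+1 (leqW Kk).
  by rewrite addSn !count_trueS; case: (t k) (t (k + q)%N) => [] []; lia.
have nd k : (K <= k)%N -> u k <= u (k + q)%N.
  move=> Kk; have : orbit_lift t u (0 + k) <= orbit_lift t u (q + k) + (- m%:Z)%:~R.
    by apply: lift_monotone => //; rewrite rmorphN /=; lra.
  by rewrite add0n rmorphN /= addnC /orbit_lift HK // natrD; lra.
apply: nondecreasing_is_cvgn.
  apply/nondecreasing_seqP => j; rewrite mulSn [(q + _)%N]addnC addnA.
  by apply: nd; rewrite leq_addr.
by exists 1 => _ [j _ <-]; have /andP[_ /ltW] := u01 (K + j * q)%N.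
Qed.

Lemma rational_rotation t u (s : R) m q : monotone_orbit t u ->
  (n%:R^-1 * (count_true t n)%:R) @[n --> \oo] --> s ->
  s * q%:R = m%:R -> (0 < q)%N ->
  exists K l, (forall k, (K <= k)%N -> t (k + q)%N = t k) /\
    u (K + j * q)%N @[j --> \oo] --> (l : R).
Proof.
move=> tu cv smq q0.
have [up|/ltW down] := leP (orbit_lift t u 0 + m%:R) (orbit_lift t u q).
  exact: rational_rotation_up cv smq up.
have s1 : s <= 1.
  apply: (cvgr_to_le cv); near=> n.
  have n0 : 0 < n%:R :> R by rewrite ltr0n; near: n; exact: nbhs_infty_gt.
  by rewrite ler_pdivrMl // mulr1 ler_nat count_true_le.
have mq : (m <= q)%N.
  by rewrite -(ler_nat R) -smq -[leRHS]mul1r ler_wpM2r.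
(* The reflected orbit has frequency [1 - s] and moves up by at least [q - m] in [q] steps. *)
have := @rational_rotation_up _ _ (1 - s) (q - m) q (monotone_orbit_negb tu) (frequency_negb cv).
rewrite !lift_negb natrB // => /(_ _ _)[||K [l [tK ul]]]; [by lra|by lra|].
exists K, (1 - l); split=> [k Kk|].
  by apply: negb_inj; exact: tK.
have -> : (fun j => u (K + j * q)%N) = (fun j => 1 - (1 - u (K + j * q)%N)).
  by apply/funext => j; ring.
by apply: cvgB => //; exact: cvg_cst.
Unshelve. all: by end_near.
Qed.

End Rotation.

(** * Norms on the plane, in coordinates *)

Section PlanarNorm.
Variables (R : realType) (nn : R -> R -> R).
Hypothesis nn_triangle :
  forall x y x' y', nn (x + x') (y + y') <= nn x y + nn x' y'.
Hypothesis nn_scale : forall t x y, nn (t * x) (t * y) = `|t| * nn x y.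
Hypothesis nn_definite : forall x y, nn x y = 0 -> x = 0 /\ y = 0.

Lemma planar_norm00 : nn 0 0 = 0.
Proof. by have := nn_scale 0 0 0; rewrite !mul0r normr0 mul0r. Qed.

Lemma planar_normN x y : nn (- x) (- y) = nn x y.
Proof. by have := nn_scale (-1) x y; rewrite !mulN1r normrN normr1 mul1r. Qed.

Lemma planar_norm_ge0 x y : 0 <= nn x y.
Proof.
have := nn_triangle x y (- x) (- y).
by rewrite !subrr planar_norm00 planar_normN; lra.
Qed.

Lemma planar_norm_gt0 (x y : R) : x != 0 \/ y != 0 -> 0 < nn x y.
Proof.
move=> xy; rewrite lt_neqAle planar_norm_ge0 andbT eq_sym; apply/eqP => /nn_definite.
by case=> x0 y0; move: xy; rewrite x0 y0 eqxx; case.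
Qed.

Lemma planar_norm_scale_ge0 (t x y : R) : 0 <= t -> nn (t * x) (t * y) = t * nn x y.
Proof. by move=> t0; rewrite nn_scale ger0_norm. Qed.

Lemma planar_norm_le x y : nn x y <= `|x| * nn 1 0 + `|y| * nn 0 1.
Proof.
have := nn_triangle x 0 0 y; rewrite addr0 add0r => /le_trans; apply.
have := nn_scale x 1 0; have := nn_scale y 0 1.
by rewrite !mulr0 !mulr1 => -> ->.
Qed.

Lemma planar_norm_triangle_sub x y x' y' :
  nn x y - nn x' y' <= nn (x + x') (y + y').
Proof.
have := nn_triangle (x + x') (y + y') (- x') (- y').
by rewrite !addrK planar_normN; lra.
Qed.

Lemma planar_norm_dist x y x' y' :
  `|nn x y - nn x' y'| <= `|x - x'| * nn 1 0 + `|y - y'| * nn 0 1.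
Proof.
have h := planar_norm_le (x - x') (y - y').
have h1 := planar_norm_triangle_sub x' y' (x - x') (y - y').
have h2 := nn_triangle (x - x') (y - y') x' y'.
rewrite !subrK in h2; rewrite !subrKC in h1.
by rewrite ler_norml; apply/andP; split; lra.
Qed.

Lemma planar_norm_cvg (u v : R ^nat) (x y : R) :
  u @ \oo --> x -> v @ \oo --> y -> nn (u n) (v n) @[n --> \oo] --> nn x y.
Proof.
move=> ux vy; apply/subr_cvg0; apply/norm_cvg0P.
pose g n := `|u n - x| * nn 1 0 + `|v n - y| * nn 0 1.
have g0 : g @ \oo --> (0 : R).
  rewrite (_ : 0 = 0 * nn 1 0 + 0 * nn 0 1); last by rewrite !mul0r addr0.
  by apply: cvgD; apply: cvgMl; apply/norm_cvg0P; apply/subr_cvg0.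
apply: (squeeze_cvgr (f := fun=> 0) (h := g)) g0; last exact: cvg_cst.
by near=> n; rewrite normr_ge0 planar_norm_dist.
Unshelve. all: by end_near.
Qed.

(** The norm of [(k * t, 1)] grows linearly in [k]. This rules out shears in the equality cases of
    the determinant bounds. *)
Lemma planar_norm_unbounded (t : R) : 0 < t ->
  (forall k, nn (k%:R * t) 1 <= nn 0 1) -> False.
Proof.
move=> t0 bnd; have E1 : 0 < nn 1 0 by apply: planar_norm_gt0; left; exact: oner_neq0.
pose k := Num.bound (2 * nn 0 1 / (t * nn 1 0)).
have := archi_boundP (x := 2 * nn 0 1 / (t * nn 1 0)).
rewrite divr_ge0 ?mulr_ge0 ?planar_norm_ge0 ?ltW //= => /(_ isT).
rewrite -/k ltr_pdivrMr ?mulr_gt0 // => kP.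
have kt_ge0 : 0 <= k%:R * t by rewrite mulr_ge0 // ltW.
have h := planar_norm_triangle_sub (k%:R * t) 0 0 1.
have h' := planar_norm_scale_ge0 1 0 kt_ge0.
rewrite addr0 add0r in h; rewrite mulr1 mulr0 in h'; rewrite h' in h.
by have := bnd k; nra.
Qed.

End PlanarNorm.

(** * Monotonicity of the Barabanov norm and the extremal orbit *)

Section BarabanovNorm.
Variables (R : realType) (nn : R -> R -> R).
Hypothesis nn_triangle :
  forall x y x' y', nn (x + x') (y + y') <= nn x y + nn x' y'.
Hypothesis nn_scale : forall t x y, nn (t * x) (t * y) = `|t| * nn x y.
Hypothesis nn_definite : forall x y, nn x y = 0 -> x = 0 /\ y = 0.
Let nn_ge0 := planar_norm_ge0 nn_triangle nn_scale.
Let nn_gt0 := planar_norm_gt0 nn_triangle nn_scale nn_definite.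
Let nn_scale_ge0 := planar_norm_scale_ge0 nn_scale.
Variables (a b c d alpha beta rho : R).
Hypothesis b_gt0 : 0 < b.
Hypothesis c_gt0 : 0 < c.
Hypothesis bc_ge1 : 1 <= b * c.
Hypothesis a_gt0 : 0 < a.
Hypothesis a_le1 : a <= 1.
Hypothesis d_gt0 : 0 < d.
Hypothesis alpha_gt0 : 0 < alpha.
Hypothesis beta_gt0 : 0 < beta.
Hypothesis rho_gt0 : 0 < rho.
Hypothesis nn_barabanov : forall x y, rho * nn x y =
  Num.max (alpha * nn (a * x + b * y) y) (beta * nn x (c * x + d * y)).

Let step0 x y : alpha * nn (a * x + b * y) y <= rho * nn x y.
Proof. by rewrite nn_barabanov le_max lexx. Qed.

Let step1 x y : beta * nn x (c * x + d * y) <= rho * nn x y.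
Proof. by rewrite nn_barabanov le_max lexx orbT. Qed.

(** [alpha] is an eigenvalue of [A0], with eigenvector [(b, 1 - a)], so [alpha <= rho]. Equality
    would force [a = 1] and [rho = alpha]; then [A0 / rho] would be a shear that never increases the
    norm. *)
Lemma det0_lt_rho2 : alpha ^+ 2 * a < rho ^+ 2.
Proof.
have alpha_le : alpha <= rho.
  have := step0 b (1 - a).
  rewrite (_ : a * b + b * (1 - a) = b); last by ring.
  by rewrite ler_pM2r //; apply: nn_gt0; left; rewrite gt_eqF.
have alpha2_le : alpha ^+ 2 <= rho ^+ 2 by rewrite ler_sqr // nnegrE ltW.
have alpha2_gt0 : 0 < alpha ^+ 2 by rewrite exprn_gt0.
have [a1|a1] := ltP a 1; first by apply: lt_le_trans alpha2_le; rewrite gtr_pMr.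
have {a1} a1 : a = 1 by apply/eqP; rewrite eq_le a_le1.
have [|rho_le] := ltP alpha rho; first by rewrite a1 mulr1 ltr_sqr // nnegrE ltW.
have e : rho = alpha by apply/eqP; rewrite eq_le rho_le.
exfalso; apply: (planar_norm_unbounded nn_triangle nn_scale nn_definite b_gt0).
elim=> [|k IH]; first by rewrite mul0r.
apply: le_trans IH; rewrite -(ler_pM2l alpha_gt0).
have := step0 (k%:R * b) 1; rewrite e a1.
by rewrite (_ : 1 * (k%:R * b) + b * 1 = k.+1%:R * b) // -natr1; ring.
Qed.

(** The eigenvalues [beta] and [beta * d] of [A1] are at most [rho]; the first settles [d < 1], the
    second [d > 1], and [d = 1] leads again to a shear. *)
Lemma det1_lt_rho2 : beta ^+ 2 * d < rho ^+ 2.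
Proof.
have betad_le : beta * d <= rho.
  have := step1 0 1; rewrite mulr0 add0r.
  have := nn_scale_ge0 0 1 (ltW d_gt0); rewrite mulr0 mulr1 => ->.
  rewrite mulrA ler_pM2r //; apply: nn_gt0; right; exact: oner_neq0.
have beta_le : beta <= rho.
  have := step1 (1 - d) c.
  rewrite (_ : c * (1 - d) + d * c = c); last by ring.
  by rewrite ler_pM2r //; apply: nn_gt0; right; rewrite gt_eqF.
have beta2_gt0 : 0 < beta ^+ 2 by rewrite exprn_gt0.
have beta2_le : beta ^+ 2 <= rho ^+ 2 by rewrite ler_sqr // nnegrE ltW.
have betad2_le : beta ^+ 2 * d ^+ 2 <= rho ^+ 2.
  by rewrite -exprMn ler_sqr // nnegrE ltW // mulr_gt0.
have [d1|d1|d1] := ltgtP d 1; first by apply: lt_le_trans beta2_le; rewrite gtr_pMr.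
  by apply: lt_le_trans betad2_le; rewrite ltr_pM2l // expr2 ltr_pMr.
have [|rho_le] := ltP beta rho; first by rewrite d1 mulr1 ltr_sqr // nnegrE ltW.
have e : rho = beta by apply/eqP; rewrite eq_le rho_le.
(* This shear moves the second coordinate, so the coordinates are swapped. *)
exfalso; have tr x y x' y' : nn (y + y') (x + x') <= nn y x + nn y' x' by exact: nn_triangle.
have sc t x y : nn (t * y) (t * x) = `|t| * nn y x by exact: nn_scale.
have df x y : nn y x = 0 -> x = 0 /\ y = 0 by case/nn_definite.
apply: (planar_norm_unbounded (nn := fun x y => nn y x) tr sc df c_gt0).
elim=> [|k IH]; first by rewrite mul0r.
apply: le_trans IH; rewrite -(ler_pM2l beta_gt0).
have := step1 1 (k%:R * c); rewrite e d1.
by rewrite (_ : c * 1 + 1 * (k%:R * c) = k.+1%:R * c) // -natr1; ring.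
Qed.

(* A cone larger than the quadrant when [d > 1]: the norm must be monotone along
   the vector [(b c - a d, c)], which leaves the quadrant when [a d > b c]. Its boundary
   ray [(- D, c)] is the line spanned by [(1 - d, c)], an eigenvector of [A1], if
   [d > 1]. *)
Let D := Num.max 0 (d - 1).
Let wide_cone w1 w2 := 0 <= w2 /\ 0 <= c * w1 + D * w2.

Lemma wide_cone_step0 w1 w2 :
  wide_cone w1 w2 -> wide_cone (alpha * (a * w1 + b * w2)) (alpha * w2).
Proof.
have D0 : 0 <= D by rewrite le_max lexx.
case=> w20 w10; split; first by rewrite mulr_ge0 // ltW.
rewrite (_ : _ + _ = alpha * (a * (c * w1 + D * w2) + w2 * (b * c + D * (1 - a)))); last by ring.
apply: mulr_ge0; first exact: ltW.
apply: addr_ge0; apply: mulr_ge0 => //; first exact: ltW.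
apply: addr_ge0; first by apply: ltW; rewrite mulr_gt0.
by apply: mulr_ge0 => //; rewrite subr_ge0.
Qed.

Lemma wide_cone_step1 w1 w2 :
  wide_cone w1 w2 -> wide_cone (beta * w1) (beta * (c * w1 + d * w2)).
Proof.
have D0 : 0 <= D by rewrite le_max lexx.
have Dd : d - 1 <= D by rewrite le_max lexx orbT.
(* This identity makes the functional [c * w1 + D * w2] a left eigenvector of [A1], for the
   eigenvalue [beta * (1 + D)]. *)
have DD : D * d = (1 + D) * D by rewrite /D; case: (leP 0 (d - 1)) => _; ring.
have dD : 0 <= d - D by move: d_gt0; rewrite /D; case: (leP 0 (d - 1)) => _; lra.
case=> w20 w10; split.
  rewrite mulr_ge0 ?(ltW beta_gt0) //.
  rewrite (_ : _ + _ = (c * w1 + D * w2) + (d - D) * w2); last by ring.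
  by apply: addr_ge0 => //; apply: mulr_ge0.
rewrite (_ : _ + _ = beta * ((1 + D) * (c * w1) + (D * d) * w2)); last by ring.
rewrite DD (_ : _ + _ = (1 + D) * (c * w1 + D * w2)); last by ring.
apply: mulr_ge0; first exact: ltW.
by apply: mulr_ge0 => //; apply: addr_ge0.
Qed.

Let C := (nn 1 0 + nn 0 1) * (nn 1 0 + nn 0 1 + D / c * nn 1 0).

(** Up to an error along an axis, [z + w] is a multiple of [z] by a factor at least 1; the error is
    the determinant over the larger coordinate of [z]. When [z1] is the larger one and [w1 < 0], the
    cone bounds both coordinates of [w] by a multiple of this quantity. *)
Lemma near_parallel_bound z1 z2 w1 w2 : 0 < z1 -> 0 < z2 -> wide_cone w1 w2 ->
  nn z1 z2 * (nn z1 z2 - nn (z1 + w1) (z2 + w2)) <= C * `|z1 * w2 - z2 * w1|.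
Proof.
move=> z10 z20 [w20 w10].
have D0 : 0 <= D by rewrite le_max lexx.
have E1 : 0 <= nn 1 0 by [].
have E2 : 0 <= nn 0 1 by [].
have F0 : 0 <= D / c * nn 1 0 by rewrite mulr_ge0 // divr_ge0 // ltW.
have Nz : 0 < nn z1 z2 by apply: nn_gt0; left; rewrite gt_eqF.
have Nle := planar_norm_le nn_triangle nn_scale z1 z2.
rewrite !gtr0_norm // in Nle.
set Delta := z1 * w2 - z2 * w1.
(* it suffices to bound the loss with one of the coordinates in place of the norm of [z] *)
have key m : 0 < m -> z1 <= m -> z2 <= m ->
    nn z1 z2 - nn (z1 + w1) (z2 + w2)
      <= (nn 1 0 + nn 0 1 + D / c * nn 1 0) * (`|Delta| / m) ->
    nn z1 z2 * (nn z1 z2 - nn (z1 + w1) (z2 + w2)) <= C * `|Delta|.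
  move=> m0 z1m z2m h.
  have Nm : nn z1 z2 <= m * (nn 1 0 + nn 0 1) by nra.
  have [neg|pos] := leP (nn z1 z2 - nn (z1 + w1) (z2 + w2)) 0.
    apply: (@le_trans _ _ 0); first by rewrite pmulr_rle0.
    by rewrite /C !mulr_ge0 ?addr_ge0.
  apply: le_trans (ler_pM (ltW Nz) (ltW pos) Nm h) _.
  have m_neq0 : m != 0 by rewrite gt_eqF.
  by rewrite /C le_eqVlt; apply/orP; left; apply/eqP; field; rewrite m_neq0 gt_eqF.
have Delta0 := normr_ge0 Delta.
have [z12|z21] := leP z1 z2.
  apply: (key z2) => //.
  have k0 : 0 <= w2 / z2 by rewrite divr_ge0 // ltW.
  have e1 : z1 + w1 = (1 + w2 / z2) * z1 + - (Delta / z2) * 1.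
    by rewrite /Delta; field; rewrite gt_eqF.
  have e2 : z2 + w2 = (1 + w2 / z2) * z2 + - (Delta / z2) * 0.
    by field; rewrite gt_eqF.
  rewrite e1 e2.
  have := planar_norm_triangle_sub nn_triangle nn_scale
    ((1 + w2 / z2) * z1) ((1 + w2 / z2) * z2) (- (Delta / z2) * 1) (- (Delta / z2) * 0).
  rewrite nn_scale_ge0 ?addr_ge0 // nn_scale normrN normrM normfV (gtr0_norm z20).
  have : 0 <= `|Delta| / z2 by rewrite divr_ge0 // ltW.
  set r := `|Delta| / z2; set k := w2 / z2 in k0 *.
  have : 0 <= k * nn z1 z2 by rewrite mulr_ge0.
  nra.
apply: (key z1) => //; first exact: ltW.
have r0 : 0 <= `|Delta| / z1 by rewrite divr_ge0 // ltW.
have [w1_ge0|w1_lt0] := leP 0 w1.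
  have k0 : 0 <= w1 / z1 by rewrite divr_ge0 // ltW.
  have e1 : z1 + w1 = (1 + w1 / z1) * z1 + (Delta / z1) * 0.
    by rewrite /Delta; field; rewrite gt_eqF.
  have e2 : z2 + w2 = (1 + w1 / z1) * z2 + (Delta / z1) * 1.
    by rewrite /Delta; field; rewrite gt_eqF.
  rewrite e1 e2.
  have := planar_norm_triangle_sub nn_triangle nn_scale
    ((1 + w1 / z1) * z1) ((1 + w1 / z1) * z2) ((Delta / z1) * 0) ((Delta / z1) * 1).
  rewrite nn_scale_ge0 ?addr_ge0 // nn_scale normrM normfV (gtr0_norm z10).
  set r := `|Delta| / z1 in r0 *; set k := w1 / z1 in k0 *.
  have : 0 <= k * nn z1 z2 by rewrite mulr_ge0.
  nra.
have Dge : z1 * w2 <= Delta by rewrite /Delta; nra.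
have w2le : w2 <= `|Delta| / z1.
  by rewrite ler_pdivlMr // mulrC (le_trans Dge) // ler_norm.
have w1le : - w1 <= D / c * (`|Delta| / z1).
  apply: (@le_trans _ _ (D / c * w2)).
    by rewrite mulrAC ler_pdivlMr //; lra.
  by rewrite ler_wpM2l // divr_ge0 // ltW.
have := planar_norm_triangle_sub nn_triangle nn_scale z1 z2 w1 w2.
have := planar_norm_le nn_triangle nn_scale w1 w2.
rewrite (ltr0_norm w1_lt0) (ger0_norm w20).
have h1 : - w1 * nn 1 0 <= D / c * (`|Delta| / z1) * nn 1 0 by rewrite ler_wpM2r.
have h2 : w2 * nn 0 1 <= (`|Delta| / z1) * nn 0 1 by rewrite ler_wpM2r.
have h3 : 0 <= `|Delta| / z1 * nn 1 0 by rewrite mulr_ge0.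
move: h1 h2 h3; set r := `|Delta| / z1; set e := D / c; nra.
Qed.

(** The larger of the determinants of [A0] and [A1]. *)
Let Q := Num.max (alpha ^+ 2 * a) (beta ^+ 2 * d).

(** At each step the matrix extremal for the first vector is applied to both. It multiplies the norm
    of that vector by [rho], the norm of the sum by at most [rho], and the determinant of the pair
    by its own determinant. *)
Lemma extremal_descent n z1 z2 w1 w2 :
  0 < z1 -> 0 < z2 -> wide_cone w1 w2 ->
  exists z1' z2' w1' w2', [/\ 0 < z1', 0 < z2', wide_cone w1' w2' &
    [/\ nn z1' z2' = rho ^+ n * nn z1 z2,
        nn (z1' + w1') (z2' + w2') <= rho ^+ n * nn (z1 + w1) (z2 + w2) &
        `|z1' * w2' - z2' * w1'| <= Q ^+ n * `|z1 * w2 - z2 * w1|]].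
Proof.
have Q0 : 0 <= Q by rewrite le_max mulr_ge0 // ?sqr_ge0 // ltW.
move=> z10 z20 w0; elim: n => [|n [u1 [u2 [v1 [v2 [u10 u20 v0 [eu ev edet]]]]]]].
  by exists z1, z2, w1, w2; rewrite !expr0 !mul1r.
have v_le : rho * nn (u1 + v1) (u2 + v2) <= rho ^+ n.+1 * nn (z1 + w1) (z2 + w2).
  by rewrite exprS -mulrA ler_pM2l.
have u_eq : rho ^+ n.+1 * nn z1 z2 = rho * nn u1 u2 by rewrite exprS -mulrA eu.
have det_le q : 0 <= q -> q <= Q ->
    `|q * (u1 * v2 - u2 * v1)| <= Q ^+ n.+1 * `|z1 * w2 - z2 * w1|.
  by move=> q0 qQ; rewrite normrM ger0_norm // exprS -mulrA ler_pM.
have [h|/ltW h] := leP (beta * nn u1 (c * u1 + d * u2)) (alpha * nn (a * u1 + b * u2) u2).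
  exists (alpha * (a * u1 + b * u2)), (alpha * u2),
         (alpha * (a * v1 + b * v2)), (alpha * v2).
  split; [by rewrite mulr_gt0 // addr_gt0 // mulr_gt0|by rewrite mulr_gt0
    |exact: wide_cone_step0|split].
  - by rewrite u_eq nn_barabanov nn_scale_ge0 ?(max_idPl h) // ltW.
  - apply: le_trans v_le; apply: le_trans (step0 _ _).
    rewrite -nn_scale_ge0 ?(ltW alpha_gt0) //.
    by rewrite le_eqVlt; apply/orP; left; apply/eqP; congr nn; ring.
  - rewrite (_ : _ - _ = alpha ^+ 2 * a * (u1 * v2 - u2 * v1)); last by ring.
    by apply: det_le; [rewrite mulr_ge0 ?sqr_ge0 // ltW|rewrite le_max lexx].
exists (beta * u1), (beta * (c * u1 + d * u2)),
       (beta * v1), (beta * (c * v1 + d * v2)).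
split; [by rewrite mulr_gt0|by rewrite mulr_gt0 // addr_gt0 // mulr_gt0
  |exact: wide_cone_step1|split].
- by rewrite u_eq nn_barabanov nn_scale_ge0 ?(max_idPr h) // ltW.
- apply: le_trans v_le; apply: le_trans (step1 _ _).
  rewrite -nn_scale_ge0 ?(ltW beta_gt0) //.
  by rewrite le_eqVlt; apply/orP; left; apply/eqP; congr nn; ring.
- rewrite (_ : _ - _ = beta ^+ 2 * d * (u1 * v2 - u2 * v1)); last by ring.
  by apply: det_le; [rewrite mulr_ge0 ?sqr_ge0 // ltW|rewrite le_max lexx orbT].
Qed.

(** Along an extremal trajectory a loss [e] and the norm of [z] both grow at least like [rho ^+ n],
    whereas their product is bounded by a constant times [Q ^+ n]. As [Q < rho ^+ 2], there is no
    loss. *)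
Lemma norm_wide_cone_homo z1 z2 w1 w2 : 0 < z1 -> 0 < z2 -> wide_cone w1 w2 ->
  nn z1 z2 <= nn (z1 + w1) (z2 + w2).
Proof.
move=> z10 z20 w0; rewrite leNgt; apply/negP; rewrite -subr_gt0.
set e := _ - _ => e0.
have Nz : 0 < nn z1 z2 by apply: nn_gt0; left; rewrite gt_eqF.
have rho20 : 0 < rho ^+ 2 by rewrite exprn_gt0.
set r := Q / rho ^+ 2.
have r1 : `|r| < 1.
  rewrite ger0_norm; last by rewrite divr_ge0 ?ltW // lt_max mulr_gt0 // exprn_gt0.
  by rewrite ltr_pdivrMr // mul1r gt_max det0_lt_rho2 det1_lt_rho2.
set K := C * `|z1 * w2 - z2 * w1|.
have bnd n : e * nn z1 z2 <= K * r ^+ n.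
  have [u1 [u2 [v1 [v2 [u10 u20 v0 [eu ev edet]]]]]] := extremal_descent n z10 z20 w0.
  have rhon : 0 < rho ^+ n by rewrite exprn_gt0.
  have C0 : 0 <= C.
    have F0 : 0 <= D / c * nn 1 0 by rewrite mulr_ge0 // divr_ge0 ?(ltW c_gt0) // le_max lexx.
    by rewrite mulr_ge0 ?addr_ge0.
  have h := le_trans (near_parallel_bound u10 u20 v0) (ler_wpM2l C0 edet).
  have h' : (rho ^+ 2) ^+ n * (e * nn z1 z2) <= K * Q ^+ n.
    rewrite (_ : K * _ = C * (Q ^+ n * `|z1 * w2 - z2 * w1|)); last by rewrite /K; ring.
    apply: le_trans h; rewrite eu -exprM mulnC exprM.
    rewrite (_ : _ * _ = rho ^+ n * nn z1 z2 * (rho ^+ n * e)); last by ring.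
    apply: ler_wpM2l; first by rewrite mulr_ge0 // ltW.
    by rewrite /e mulrBr lerD2l lerN2.
  by rewrite /r expr_div_n mulrA ler_pdivlMr ?exprn_gt0 // mulrC.
have cv : K * r ^+ n @[n --> \oo] --> (0 : R).
  by rewrite -(mulr0 K); apply: cvgMr; exact: cvg_expr.
have en : 0 < e * nn z1 z2 by rewrite mulr_gt0.
have [n _ hn] := cvgr_lt _ cv _ en.
by have := hn n (leqnn n); rewrite ltNge bnd.
Qed.

(** Suppose [A1] strictly better at the smaller slope and [A0] at the larger one. Scaling by [l] and
    [l'] gives the images by [A1] equal second coordinates; the images by either matrix then differ
    by a vector of the cone, and monotonicity closes a strict cycle of inequalities. *)
Lemma extremal_threshold x1 x2 y1 y2 : 0 < x1 -> 0 < x2 -> 0 < y1 -> 0 < y2 ->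
  x1 * y2 < y1 * x2 ->
  alpha * nn (a * x1 + b * x2) x2 = rho * nn x1 x2 \/
  beta * nn y1 (c * y1 + d * y2) = rho * nn y1 y2.
Proof.
move=> x10 x20 y10 y20 xy.
have := nn_barabanov x1 x2; have := nn_barabanov y1 y2.
have [_ ->|yN eyN] := leP (alpha * nn (a * y1 + b * y2) y2) _; first by right.
have [_ ->|xN exN] := leP (beta * nn x1 (c * x1 + d * x2)) _; first by left.
exfalso.
set l' := d * x2 + c * x1; set l := d * y2 + c * y1.
have l'0 : 0 < l' by rewrite addr_gt0 // mulr_gt0.
have l0 : 0 < l by rewrite addr_gt0 // mulr_gt0.
set Delta := y1 * x2 - x1 * y2.
have Delta0 : 0 < Delta by rewrite subr_gt0.
have h1 : l * nn x1 (c * x1 + d * x2) <= l' * nn y1 (c * y1 + d * y2).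
  rewrite -!nn_scale_ge0 ?(ltW l0) ?(ltW l'0) //.
  rewrite (_ : l' * y1 = l * x1 + Delta * d); last by rewrite /l' /l /Delta; ring.
  rewrite (_ : l' * _ = l * (c * x1 + d * x2) + 0); last by rewrite /l' /l; ring.
  apply: norm_wide_cone_homo; rewrite ?mulr_gt0 ?addr_gt0 ?mulr_gt0 //; split => //.
  by rewrite mulr0 addr0 !mulr_ge0 ?ltW.
have h2 : l' * nn (a * y1 + b * y2) y2 <= l * nn (a * x1 + b * x2) x2.
  rewrite -!nn_scale_ge0 ?(ltW l0) ?(ltW l'0) //.
  rewrite (_ : l * x2 = l' * y2 + Delta * c); last by rewrite /l' /l /Delta; ring.
  rewrite (_ : l * _ = l' * (a * y1 + b * y2) + Delta * (b * c - a * d)); last first.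
    by rewrite /l' /l /Delta; ring.
  apply: norm_wide_cone_homo; rewrite ?mulr_gt0 ?addr_gt0 ?mulr_gt0 //.
  split; first by rewrite mulr_ge0 ?ltW.
  (* The last factor is nonnegative because [b c - a d + d - 1 = (b c - 1) + d (1 - a)]. *)
  rewrite (_ : _ + _ = c * Delta * (b * c - a * d + D)); last by ring.
  apply: mulr_ge0; first by rewrite mulr_ge0 ?ltW.
  have : d - 1 <= D by rewrite le_max lexx orbT.
  have : 0 <= d * (1 - a) by apply: mulr_ge0; [exact: ltW|rewrite subr_ge0].
  by move: bc_ge1; lra.
have h3 : beta * (l * nn x1 (c * x1 + d * x2)) <= beta * (l' * nn y1 (c * y1 + d * y2)).
  by rewrite ler_pM2l.
have h4 : alpha * (l' * nn (a * y1 + b * y2) y2) <= alpha * (l * nn (a * x1 + b * x2) x2).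
  by rewrite ler_pM2l.
have h5 : l' * (beta * nn y1 (c * y1 + d * y2)) < l' * (alpha * nn (a * y1 + b * y2) y2).
  by rewrite ltr_pM2l.
have h6 : l * (alpha * nn (a * x1 + b * x2) x2) < l * (beta * nn x1 (c * x1 + d * x2)).
  by rewrite ltr_pM2l.
lra.
Qed.

(* [A1] is selected exactly when it is extremal for all the directions of
   larger slope [x / y]; by the threshold, [A0] is extremal otherwise. *)
Let select1 (p : R * R) := `[< forall x y, 0 < x -> 0 < y -> p.1 * y <= x * p.2 ->
  beta * nn x (c * x + d * y) = rho * nn x y >].

Let next (p : R * R) :=
  if select1 p then (beta * p.1, beta * (c * p.1 + d * p.2))
  else (alpha * (a * p.1 + b * p.2), alpha * p.2).

Let next_gt0 p : 0 < p.1 -> 0 < p.2 -> 0 < (next p).1 /\ 0 < (next p).2.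
Proof.
by rewrite /next; case: (select1 p) => p1 p2; split; rewrite /= ?mulr_gt0 ?addr_gt0 ?mulr_gt0.
Qed.

Let next_extremal p : 0 < p.1 -> 0 < p.2 ->
  nn (next p).1 (next p).2 = rho * nn p.1 p.2.
Proof.
rewrite /next; case: ifPn => [/asboolP sel|/asboolPn nsel] p1 p2 /=.
  by rewrite nn_scale_ge0 ?(ltW beta_gt0) // sel.
rewrite nn_scale_ge0 ?(ltW alpha_gt0) //.
have [//|nX0] := pselect (alpha * nn (a * p.1 + b * p.2) p.2 = rho * nn p.1 p.2).
have X1 : beta * nn p.1 (c * p.1 + d * p.2) = rho * nn p.1 p.2.
  have := nn_barabanov p.1 p.2.
  by have [_ ->//|_ e] := leP (alpha * nn (a * p.1 + b * p.2) p.2) _; case: nX0; rewrite e.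
(* [A1] is extremal on the ray of [p] by homogeneity, and at larger slopes by the threshold since
   [A0] fails at [p]; hence it would have been selected. *)
exfalso; apply: nsel => x y x0 y0; rewrite le_eqVlt => /orP[/eqP e|lt_px].
  pose k := x / p.1.
  have ex : x = k * p.1 by rewrite /k divfK // gt_eqF.
  have ey : y = k * p.2 by apply: (mulfI (lt0r_neq0 p1)); rewrite e {1}ex; ring.
  have k0 : 0 <= k by rewrite divr_ge0 // ltW.
  rewrite ex ey (_ : c * _ + _ = k * (c * p.1 + d * p.2)); last by ring.
  by rewrite !nn_scale_ge0 // mulrCA X1 mulrCA.
by have [] := extremal_threshold p1 p2 x0 y0 lt_px.
Qed.

(** The coordinate [x / (x + y)] increases with the slope and lies in [(0, 1)]; each matrix
    preserves the order of slopes, its determinant being positive. *)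
Lemma monotone_extremal_orbit : exists (t : nat -> bool) (x y : nat -> R),
  [/\ x 0%N = 1 /\ y 0%N = 1,
      forall k, 0 < x k /\ 0 < y k,
      forall k, (x k.+1, y k.+1) =
        if t k then (beta * x k, beta * (c * x k + d * y k))
        else (alpha * (a * x k + b * y k), alpha * y k),
      forall k, nn (x k.+1) (y k.+1) = rho * nn (x k) (y k) &
      monotone_orbit t (fun k => x k / (x k + y k))].
Proof.
pose p k := iter k next (1, 1).
have p0 k : 0 < (p k).1 /\ 0 < (p k).2.
  by elim: k => [|k [? ?]]; [split; exact: ltr01|apply: next_gt0].
have u_le j k : ((p j).1 / ((p j).1 + (p j).2) <= (p k).1 / ((p k).1 + (p k).2))
    = ((p j).1 * (p k).2 <= (p k).1 * (p j).2).
  have [? ?] := p0 j; have [? ?] := p0 k.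
  rewrite ler_pdivrMr ?addr_gt0 // mulrAC ler_pdivlMr ?addr_gt0 //.
  by rewrite !mulrDr [X in X + _]mulrC lerD2l.
exists (fun k => select1 (p k)), (fun k => (p k).1), (fun k => (p k).2).
split=> // [k|k|].
- by rewrite /p iterS -/(p k) /next; case: (select1 (p k)).
- by have [? ?] := p0 k; rewrite /p iterS -/(p k) next_extremal.
split=> [k|j k|j k|j k]; rewrite ?u_le.
- have [? ?] := p0 k.
  by rewrite divr_gt0 ?addr_gt0 //= ltr_pdivrMr ?addr_gt0 // mul1r ltrDl.
- have [pj1 pj2] := p0 j; have [pk1 pk2] := p0 k.
  move=> jk /asboolP sel; apply/asboolP => x y x0 y0 kx; apply: sel => //.
  rewrite -(ler_pM2r pk2).
  have h1 : (p j).1 * (p k).2 * y <= (p k).1 * (p j).2 * y by rewrite ler_pM2r.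
  have h2 : (p k).1 * y * (p j).2 <= x * (p k).2 * (p j).2 by rewrite ler_pM2r.
  lra.
- move=> tjk jk; rewrite /p !iterS -!/(p _) /next tjk.
  case: (select1 (p k)) => /=.
    rewrite -!mulrA !(ler_pM2l beta_gt0) !(mulrCA _ beta) !(ler_pM2l beta_gt0).
    rewrite !mulrDr !(mulrCA _ c) !(mulrCA _ d) [(p j).1 * (p k).1]mulrC lerD2l.
    by rewrite ler_pM2l.
  rewrite -!mulrA !(ler_pM2l alpha_gt0) !(mulrCA _ alpha) !(ler_pM2l alpha_gt0).
  rewrite !mulrDl -!mulrA [(p j).2 * _]mulrC lerD2r ler_pM2l //.
(* Images by [A1] have slope below [1 / c], images by [A0] have slope above [b], and
   [1 / c <= b]. *)
- move=> tj /negbTE tk; rewrite /p !iterS -!/(p _) /next tj tk /=.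
  have [pj1 pj2] := p0 j; have [pk1 pk2] := p0 k.
  rewrite mulrACA [leRHS]mulrACA [alpha * beta]mulrC ler_pM2l ?mulr_gt0 //.
  rewrite (_ : (_ + _) * _ = b * c * ((p j).1 * (p k).2)
    + (a * (p k).1 * (c * (p j).1 + d * (p j).2) + b * (p k).2 * (d * (p j).2))).
    rewrite -[leLHS]addr0 lerD // ?ler_peMl ?mulr_ge0 ?(ltW pj1) ?(ltW pk2) //.
    by rewrite ltW // addr_gt0 ?mulr_gt0 ?addr_gt0 ?mulr_gt0.
  ring.
Qed.

End BarabanovNorm.

(** * Matrices of size two and their spectrum *)

Lemma det_mx22 (S : comNzRingType) (M : 'M[S]_2) :
  \det M = M 0 0 * M 1 1 - M 0 1 * M 1 0.
Proof.
rewrite (expand_det_row _ 0) !big_ord_recl big_ord0 /cofactor !det_mx11 !mxE /=.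
rewrite (_ : lift 0 0 = 1); last exact: val_inj.
rewrite (_ : lift 1 0 = 0); last exact: val_inj.
by rewrite /bump /=; ring.
Qed.

Lemma char_poly_mx22 (S : comNzRingType) (M : 'M[S]_2) (l1 l2 : S) :
  l1 + l2 = M 0 0 + M 1 1 -> l1 * l2 = M 0 0 * M 1 1 - M 0 1 * M 1 0 ->
  char_poly M = ('X - l1%:P) * ('X - l2%:P).
Proof.
move=> tr det; rewrite /char_poly det_mx22 !mxE /= !mulr1n !mulr0n !sub0r mulrNN.
transitivity ('X ^+ 2 - (l1 + l2)%:P * 'X + (l1 * l2)%:P : {poly S}).
  rewrite tr det !polyCD !polyCN !polyCM; ring.
rewrite !polyCD !polyCM; ring.
Qed.

Lemma mulmx22E (S : pzRingType) n (M : 'M[S]_2) (v : 'M[S]_(2, n)) i j :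
  (M *m v) i j = M i 0 * v 0 j + M i 1 * v 1 j.
Proof.
rewrite mxE !big_ord_recl big_ord0 addr0.
by rewrite (_ : lift 0 0 = 1) //; exact: val_inj.
Qed.

Lemma colv2_eqP (S : pzRingType) (v w : 'cV[S]_2) :
  v 0 0 = w 0 0 -> v 1 0 = w 1 0 -> v = w.
Proof.
move=> h0 h1; apply/matrixP => i j; rewrite (ord1 j).
by case: i => [] [|[|//]] hi; [move: h0|move: h1];
  congr (_ = _); congr fun_of_matrix; exact: val_inj.
Qed.

Lemma colv2_parallel (F : fieldType) (v w : 'cV[F]_2) : v != 0 ->
  w 0 0 * v 1 0 = w 1 0 * v 0 0 -> exists l, w = l *: v.
Proof.
move=> v0 wv; have [v00|v00] := eqVneq (v 0 0) 0.
  have v10 : v 1 0 != 0.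
    by apply: contra v0 => /eqP v10; apply/eqP; apply: colv2_eqP; rewrite mxE.
  exists (w 1 0 / v 1 0); apply: colv2_eqP; rewrite !mxE ?divfK //.
  by apply: (mulIf v10); rewrite wv v00; ring.
exists (w 0 0 / v 0 0); apply: colv2_eqP; rewrite !mxE ?divfK //.
by rewrite mulrAC wv mulfK.
Qed.

Lemma col_eigenvalue (F : fieldType) n (M : 'M[F]_n) l :
  reflect (exists2 v : 'cV[F]_n, M *m v = l *: v & v != 0) (eigenvalue M^T l).
Proof.
apply: (iffP eigenvalueP) => -[v e v0]; exists v^T; rewrite ?trmx_eq0 //.
  by rewrite -[LHS]trmxK trmx_mul trmxK e linearZ.
by rewrite -trmx_mul e linearZ.
Qed.

Section RealSpectrum.
Variables (R : realType) (M : 'M[R]_2).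
Hypothesis disc_ge0 : 0 <= (M 0 0 - M 1 1) ^+ 2 + 4 * (M 0 1 * M 1 0).

(** The discriminant of the characteristic polynomial is nonnegative, so the complex eigenvalues are
    the real numbers [l1] and [l2], with real eigenvectors. *)
Lemma spectral_radius_real_spectrum :
  (exists2 l, (exists2 v : 'cV[R]_2, M *m v = l *: v & v != 0)
     & spectral_radius M = `|l|) /\
  (forall l (v : 'cV[R]_2), M *m v = l *: v -> v != 0 -> `|l| <= spectral_radius M).
Proof.
set D := Num.sqrt ((M 0 0 - M 1 1) ^+ 2 + 4 * (M 0 1 * M 1 0)).
have D2 : D ^+ 2 = (M 0 0 - M 1 1) ^+ 2 + 4 * (M 0 1 * M 1 0) by rewrite sqr_sqrtr.
pose l1 := (M 0 0 + M 1 1 + D) / 2; pose l2 := (M 0 0 + M 1 1 - D) / 2.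
have tr : l1 + l2 = M 0 0 + M 1 1 by rewrite /l1 /l2; field.
have det : l1 * l2 = M 0 0 * M 1 1 - M 0 1 * M 1 0.
  transitivity (((M 0 0 + M 1 1) ^+ 2 - D ^+ 2) / 4); first by rewrite /l1 /l2; field.
  by rewrite D2; field.
have cp := char_poly_mx22 tr det.
have cpT : char_poly M^T = ('X - l1%:P) * ('X - l2%:P).
  by apply: char_poly_mx22; rewrite !mxE // det [M 0 1 * _]mulrC.
have eigT l : eigenvalue M^T l = (l == l1) || (l == l2).
  by rewrite eigenvalue_root_char cpT rootM !root_XsubC.
have eigC (z : R[i]) : eigenvalue (map_mx (real_complex R) M) z
    = (z == real_complex R l1) || (z == real_complex R l2).
  rewrite eigenvalue_root_char -map_char_poly cp rmorphM /= !map_polyXsubC.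
  by rewrite rootM !root_XsubC.
have normR (x : R) : Normc.normc (real_complex R x) = `|x|.
  by rewrite /= expr0n addr0 sqrtr_sqr.
have SE : [set Normc.normc z | z in [set z : R[i] | eigenvalue (map_mx (real_complex R) M) z]]
    = [set `|l1|; `|l2|].
  apply/seteqP; split=> [x [z /= ] |x /= []->].
  - by rewrite eigC => /orP[] /eqP -> <-; rewrite normR; [left|right].
  - by exists (real_complex R l1); [rewrite /= eigC eqxx|exact: normR].
  - by exists (real_complex R l2); [rewrite /= eigC eqxx orbT|exact: normR].
have srE : spectral_radius M = Num.max `|l1| `|l2|.
  rewrite /spectral_radius SE; apply/eqP; rewrite eq_le; apply/andP; split.
    apply: ge_sup; first by exists `|l1|; left.
    by move=> x [] ->; rewrite le_max lexx ?orbT.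
  rewrite ge_max; apply/andP; split; apply: ub_le_sup; try (by left); try (by right).
    by exists (Num.max `|l1| `|l2|) => x [] ->; rewrite le_max lexx ?orbT.
  by exists (Num.max `|l1| `|l2|) => x [] ->; rewrite le_max lexx ?orbT.
split=> [|l v e v0].
  rewrite srE; have [_|_] := leP `|l1| `|l2|; [exists l2|exists l1] => //.
    by apply/col_eigenvalue; rewrite eigT eqxx orbT.
  by apply/col_eigenvalue; rewrite eigT eqxx.
have /col_eigenvalue : exists2 v : 'cV[R]_2, M *m v = l *: v & v != 0 by exists v.
by rewrite eigT srE => /orP[] /eqP ->; rewrite le_max lexx ?orbT.
Qed.

End RealSpectrum.

(** * Switched products and periodic laws *)

Section SwitchedProducts.
Variables (R : realType) (m : nat) (A0 A1 : 'M[R]_m).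
Implicit Types i : nat -> bool.

Lemma switched_productE i n :
  switched_product A0 A1 i n = \prod_(k < n) (if i (n - k)%N then A1 else A0).
Proof.
elim: n => [|n IH]; first by rewrite big_ord0.
by rewrite big_ord_recl /= subn0 IH.
Qed.

Lemma switched_product_mem i n :
  mx_products [set A0; A1] n (switched_product A0 A1 i n).
Proof.
exists (fun k : 'I_n => if i (n - k)%N then A1 else A0); last by rewrite switched_productE.
by move=> k /=; case: ifP; [right|left].
Qed.

Lemma switched_productD i n p :
  switched_product A0 A1 i (n + p)%N
  = switched_product A0 A1 (fun k => i (n + k)%N) p *m switched_product A0 A1 i n.
Proof.
elim: p => [|p IH]; first by rewrite addn0 mul1mx.
by rewrite addnS /= IH mulmxA addnS.
Qed.

Lemma eq_switched_product i j n : (forall k, (0 < k)%N -> i k = j k) ->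
  switched_product A0 A1 i n = switched_product A0 A1 j n.
Proof. by move=> ij; elim: n => //= n ->; rewrite ij. Qed.

Lemma mx_products_rcons n M : mx_products [set A0; A1] n.+1 M ->
  exists A M', [/\ A = A0 \/ A = A1, mx_products [set A0; A1] n M' & M = A *m M'].
Proof.
case=> F hF <-; exists (F ord0), (\prod_(k < n) F (lift ord0 k)); split => //.
- exact: hF.
- by exists (fun k => F (lift ord0 k)) => // k; exact: hF.
- by rewrite big_ord_recl.
Qed.

Lemma mx_products_periodic_law n M : (0 < n)%N -> mx_products [set A0; A1] n M ->
  exists i, switched_product A0 A1 i n = M /\
    forall k, (0 < k)%N -> i (k + n)%N = i k.
Proof.
case: n => // n _ [F hF <-].
(* The rightmost factor acts first. *)
pose i j := F (rev_ord (inord (j.-1 %% n.+1))) == A1.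
exists i; split=> [|[//|k] _]; last by rewrite /i addSn /= modnDr.
rewrite switched_productE; apply: eq_bigr => k _.
have -> : i (n.+1 - k)%N = (F k == A1).
  rewrite /i; congr (F _ == _); apply: val_inj => /=.
  have kn := ltn_ord k.
  rewrite inordK ?ltn_mod // modn_small; lia.
by case: eqP => [->//|ne]; case: (hF k).
Qed.

Variables (N : 'cV[R]_m -> R) (hN : Barabanov_norm A0 A1 N).
Let rho := generalized_spectral_radius [set A0; A1].
Hypothesis rho_gt0 : 0 < rho.

Lemma mx_products_norm_le n M x :
  mx_products [set A0; A1] n M -> N (M *m x) <= rho ^+ n * N x.
Proof.
have [_ bar] := hN.
elim: n M => [|n IH] M.
  by case=> F _ <-; rewrite big_ord0 mul1mx expr0 mul1r.
case/mx_products_rcons => A [M' [hA hM' ->]]; rewrite -mulmxA.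
apply: (@le_trans _ _ (rho * N (M' *m x))).
  by rewrite [leRHS]bar le_max; case: hA => ->; rewrite lexx ?orbT.
by rewrite exprS -mulrA ler_pM2l // IH.
Qed.

(** Over whole periods the growth is exactly extremal. Each step gains at most a factor [rho], so a
    loss at time [k] could not be recovered by the time [n * k], a multiple of the period. *)
Lemma periodic_extremal_law n i (v : 'cV[R]_m) l : (0 < n)%N ->
  (forall k, (0 < k)%N -> i (k + n)%N = i k) ->
  switched_product A0 A1 i n *m v = l *: v -> `|l| = rho ^+ n ->
  extremal_law A0 A1 N v i.
Proof.
move=> n0 per ev lE k _.
have iter j : switched_product A0 A1 i (n * j) *m v = l ^+ j *: v.
  elim: j => [|j IH]; first by rewrite muln0 expr0 scale1r mul1mx.
  have perj p : (0 < p)%N -> i (n * j + p)%N = i p.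
    move=> p0; elim: j {IH} => [|j IH]; first by rewrite muln0.
    by rewrite mulnS -addnA addnC per ?addn_gt0 ?p0 ?orbT.
  rewrite mulnSr switched_productD -mulmxA IH -scalemxAr.
  by rewrite (eq_switched_product n perj) ev scalerA -exprSr.
apply/eqP; rewrite eq_le mx_products_norm_le /=; last exact: switched_product_mem.
have [[_ sc _] _] := hN.
have h : N (switched_product A0 A1 i (n * k) *m v) = rho ^+ (n * k) * N v.
  by rewrite iter sc normrX lE exprM.
have kn : (k <= n * k)%N by rewrite leq_pmull.
rewrite -(ler_pM2l (exprn_gt0 (n * k - k) rho_gt0)).
rewrite mulrA -exprD subnK // -h -{1}(subnKC kn) switched_productD -mulmxA.
by apply: mx_products_norm_le; exact: switched_product_mem.
Qed.

End SwitchedProducts.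

(** * Sign patterns of the products *)

Section SignPattern.
Variable R : realType.

(* The matrices [M] such that [diag(1, e) M diag(1, e)] is nonnegative. *)
Definition sign_pattern (e : R) (M : 'M[R]_2) : Prop :=
  [/\ 0 <= M 0 0, 0 <= M 1 1, 0 <= e * M 0 1 & 0 <= e * M 1 0].

Lemma sign_pattern_mul e (M M' : 'M[R]_2) : e ^+ 2 = 1 ->
  sign_pattern e M -> sign_pattern e M' -> sign_pattern e (M *m M').
Proof.
move=> e2 [h1 h2 h3 h4] [k1 k2 k3 k4]; split; rewrite mulmx22E.
- rewrite -[M 0 1 * _]mul1r -e2 (_ : e ^+ 2 * _ = (e * M 0 1) * (e * M' 1 0)); last by ring.
  by apply: addr_ge0; apply: mulr_ge0.
- rewrite -[M 1 0 * _]mul1r -e2 (_ : e ^+ 2 * _ = (e * M 1 0) * (e * M' 0 1)); last by ring.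
  by apply: addr_ge0; apply: mulr_ge0.
- rewrite (_ : e * _ = M 0 0 * (e * M' 0 1) + (e * M 0 1) * M' 1 1); last by ring.
  by apply: addr_ge0; apply: mulr_ge0.
- rewrite (_ : e * _ = (e * M 1 0) * M' 0 0 + M 1 1 * (e * M' 1 0)); last by ring.
  by apply: addr_ge0; apply: mulr_ge0.
Qed.

(** Conjugation by [diag(1, e)] does not change the product of the off-diagonal entries, which is
    thus nonnegative. *)
Lemma sign_pattern_disc_ge0 e (M : 'M[R]_2) : e ^+ 2 = 1 -> sign_pattern e M ->
  0 <= (M 0 0 - M 1 1) ^+ 2 + 4 * (M 0 1 * M 1 0).
Proof.
move=> e2 [_ _ h3 h4].
have -> : M 0 1 * M 1 0 = e * M 0 1 * (e * M 1 0) by rewrite mulrACA -expr2 e2 mul1r.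
by apply: addr_ge0; [exact: sqr_ge0|apply: mulr_ge0; [exact: ler0n|exact: mulr_ge0]].
Qed.

Lemma sign_pattern_mx_products e (A0 A1 : 'M[R]_2) n M : e ^+ 2 = 1 ->
  sign_pattern e A0 -> sign_pattern e A1 ->
  mx_products [set A0; A1] n M -> sign_pattern e M.
Proof.
move=> e2 h0 h1; elim: n M => [|n IH] M.
  by case=> F _ <-; rewrite big_ord0; split; rewrite !mxE /= ?mulr0n ?mulr1n ?mulr0.
by case/mx_products_rcons => A [M' [[]-> /IH hM' ->]]; apply: sign_pattern_mul.
Qed.

End SignPattern.

(** * Frequencies of periodic words *)

Section Frequency.
Variable R : realType.

Lemma sum_law_count_true (i : nat -> bool) n :
  \sum_(1 <= k < n.+1) (i k)%:R = (count_true (fun k => i k.+1) n)%:R :> R.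
Proof.
rewrite /count_true natr_sum -(big_mkord xpredT (fun k => (i k.+1)%:R)).
by rewrite big_add1.
Qed.

Lemma count_true_periodic (t : nat -> bool) n j : (forall k, t (k + n)%N = t k) ->
  count_true t (n * j) = (j * count_true t n)%N.
Proof.
move=> per; elim: j => [|j IH]; first by rewrite muln0 /count_true big_ord0.
have add p : count_true t (p + n) = (count_true t n + count_true t p)%N.
  elim: p => [|p IHp]; first by rewrite add0n {3}/count_true big_ord0 addn0.
  by rewrite addSn !count_trueS IHp per addnA.
by rewrite mulnSr add IH mulSn.
Qed.

(** The averages are constant along the positive multiples of the period. *)
Lemma periodic_frequency (t : nat -> bool) n (s : R) : (0 < n)%N ->
  (forall k, t (k + n)%N = t k) ->
  (k%:R^-1 * (count_true t k)%:R) @[k --> \oo] --> s ->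
  s = (count_true t n)%:R / n%:R.
Proof.
move=> n0 per cv; apply/eqP; rewrite -subr_eq0 -normr_eq0; apply/eqP/le_anti.
rewrite normr_ge0 andbT; apply/ler_addgt0Pr => e e0; rewrite add0r.
have [K _ hK] : \forall k \near \oo, `|s - k%:R^-1 * (count_true t k)%:R| < e.
  by move/cvgrPdist_lt: cv; apply.
have KN : K.+1%:R != 0 :> R by rewrite pnatr_eq0.
have KnK : (K <= n * K.+1)%N by nia.
have := hK _ KnK; rewrite /= count_true_periodic // !natrM.
rewrite (_ : (n%:R * _)^-1 * _ = (count_true t n)%:R / n%:R); first exact: ltW.
by rewrite invfM -mulrA mulKf // mulrC.
Qed.

End Frequency.

(** * The two implications, in coordinates adapted to the signs *)

Section SignedPair.
Variables (R : realType) (a b c d alpha beta : R).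
Hypotheses (alpha_gt0 : 0 < alpha) (beta_gt0 : 0 < beta) (bc_ge1 : 1 <= b * c).
Hypotheses (a_le1 : a <= 1) (a_gt0 : 0 < a) (d_gt0 : 0 < d).
Let A0 := alpha *: mx22 a b 0 1.
Let A1 := beta *: mx22 1 0 c d.
Let rho := generalized_spectral_radius [set A0; A1].
Variable N : 'cV[R]_2 -> R.
Hypothesis hN : Barabanov_norm A0 A1 N.

Let e := Num.sg b.

Let b_neq0 : b != 0.
Proof. by apply/eqP => b0; move: bc_ge1; rewrite b0 mul0r ler10. Qed.

Let e2 : e ^+ 2 = 1. Proof. by rewrite /e sqr_sg b_neq0. Qed.

Let eb_gt0 : 0 < e * b.
Proof. by rewrite /e -normrEsg normr_gt0. Qed.

Let ebc : e * b * (e * c) = b * c.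
Proof. by rewrite mulrACA -expr2 e2 mul1r. Qed.

Let ec_gt0 : 0 < e * c.
Proof. by rewrite -(pmulr_rgt0 _ eb_gt0) ebc (lt_le_trans ltr01). Qed.

(** Coordinates after conjugation by [diag(1, e)]: the off-diagonal entries [b] and [c] become the
    positive numbers [e * b] and [e * c]. *)
Definition signed_col (x y : R) : 'cV[R]_2 := \col_(i < 2) if i == 0 then x else e * y.

Lemma signed_colE (w : 'cV[R]_2) : w = signed_col (w 0 0) (e * w 1 0).
Proof. by apply: colv2_eqP; rewrite !mxE //= mulrA -expr2 e2 mul1r. Qed.

Lemma signed_colD x y x' y' :
  signed_col (x + x') (y + y') = signed_col x y + signed_col x' y'.
Proof. by apply: colv2_eqP; rewrite !mxE //= mulrDr. Qed.

Lemma signed_colZ t x y : signed_col (t * x) (t * y) = t *: signed_col x y.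
Proof. by apply: colv2_eqP; rewrite !mxE //= mulrCA. Qed.

Lemma mul_A0_signed_col x y :
  A0 *m signed_col x y = alpha *: signed_col (a * x + e * b * y) y.
Proof.
rewrite -scalemxAl; congr (_ *: _); apply: colv2_eqP; rewrite mulmx22E !mxE /=.
  by ring.
by rewrite mul0r mul1r add0r.
Qed.

Lemma mul_A1_signed_col x y :
  A1 *m signed_col x y = beta *: signed_col x (e * c * x + d * y).
Proof.
rewrite -scalemxAl; congr (_ *: _); apply: colv2_eqP; rewrite mulmx22E !mxE /=.
  by rewrite mul0r mul1r addr0.
rewrite mulrDr !mulrA -expr2 e2 mul1r; ring.
Qed.

Let nn x y := N (signed_col x y).

Let nn_triangle x y x' y' : nn (x + x') (y + y') <= nn x y + nn x' y'.
Proof. by rewrite /nn signed_colD; case: hN => -[]. Qed.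

Let nn_scale t x y : nn (t * x) (t * y) = `|t| * nn x y.
Proof. by rewrite /nn signed_colZ; case: hN => -[]. Qed.

Let nn_definite x y : nn x y = 0 -> x = 0 /\ y = 0.
Proof.
case: hN => -[_ _ df] _ /df /matrixP h; have := h 0 0; have := h 1 0.
rewrite !mxE /= => /eqP; rewrite mulf_eq0 /e sgr_eq0 (negbTE b_neq0) /=.
by move=> /eqP.
Qed.

Let nn_barabanov x y : rho * nn x y =
  Num.max (alpha * nn (a * x + e * b * y) y) (beta * nn x (e * c * x + d * y)).
Proof.
case: hN => -[_ sc _] bar; rewrite /nn bar mul_A0_signed_col mul_A1_signed_col.
by rewrite !sc !gtr0_norm.
Qed.

Lemma rho_gt0 : 0 < rho.
Proof.
have gt0 x y : 0 < x -> 0 < nn x y.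
  by move=> x0; apply: (planar_norm_gt0 nn_triangle nn_scale nn_definite); left; rewrite gt_eqF.
rewrite -(pmulr_lgt0 _ (gt0 1 1 ltr01)) nn_barabanov lt_max.
by rewrite mulr_gt0 ?gt0 ?addr_gt0 ?mulr1.
Qed.

Lemma sign_pattern_products n M : mx_products [set A0; A1] n M -> sign_pattern e M.
Proof.
apply: sign_pattern_mx_products => //; split;
  rewrite !mxE /= ?mulr0 ?mulr1 ?(ltW alpha_gt0) ?(ltW beta_gt0) //.
- by rewrite mulr_ge0 ?ltW.
- by rewrite mulrCA mulr_ge0 ?ltW.
- by rewrite mulr_ge0 ?ltW.
- by rewrite mulrCA mulr_ge0 ?ltW.
Qed.

Let disc_ge0 n M (hM : mx_products [set A0; A1] n M) :=
  sign_pattern_disc_ge0 e2 (sign_pattern_products hM).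

Lemma spectral_finiteness_rational s : is_switching_frequency A0 A1 N s ->
  spectral_finiteness [set A0; A1] -> rational s.
Proof.
move=> hs [n [n0 [M hM]]]; rewrite -/rho => rhoE.
have [[l [v Mv v0] srl] _] := spectral_radius_real_spectrum (disc_ge0 hM).
have lE : `|l| = rho ^+ n.
  rewrite rhoE srl -powR_mulrn ?powR_ge0 // -powRrM mulVf ?pnatr_eq0 -?lt0n //.
  by rewrite powRr1.
(* [M] multiplies the norm of [v] by [rho ^+ n], the largest growth possible in [n] steps, so
   repeating the word of [M] is extremal. *)
have [i [iM per]] := mx_products_periodic_law n0 hM.
have ext : extremal_law A0 A1 N v i.
  by apply: (periodic_extremal_law hN rho_gt0 n0 per _ lE); rewrite iM.
have := hs v i v0 ext.
under eq_fun do rewrite sum_law_count_true.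
move=> cv; rewrite (periodic_frequency n0 _ cv); last by move=> k; rewrite -addSn per.
by apply/rationalP; exists (count_true (fun k => i k.+1) n)%:Z, n.
Qed.

(** The factors [kappa] are not assumed to converge, so they are eliminated: parallelism is written
    as a cross product relation, which passes to the limit. Continuity of the norm then gives the
    modulus of the eigenvalue. *)
Lemma limit_direction_eigenvector (M : 'M[R]_2) (u kappa : R ^nat) (l r : R) :
  u @ \oo --> l ->
  (forall n, M *m signed_col (u n) (1 - u n)
     = kappa n *: signed_col (u n.+1) (1 - u n.+1)) ->
  (forall n, N (M *m signed_col (u n) (1 - u n)) = r * N (signed_col (u n) (1 - u n))) ->
  exists2 lam, (exists2 v : 'cV[R]_2, M *m v = lam *: v & v != 0) & `|lam| = r.
Proof.
move=> ul Mu Nu.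
pose f0 x := M 0 0 * x + M 0 1 * (e * (1 - x)).
pose f1 x := M 1 0 * x + M 1 1 * (e * (1 - x)).
have ME x : M *m signed_col x (1 - x) = signed_col (f0 x) (e * f1 x).
  by rewrite [LHS]signed_colE !mulmx22E !mxE.
have lim_unique (v v' : R ^nat) (k k' : R) :
    (forall n, v n = v' n) -> v @ \oo --> k -> v' @ \oo --> k' -> k = k'.
  by move=> /funext -> h h'; rewrite -(cvg_lim _ h) // (cvg_lim _ h').
have cB (v : R ^nat) (k : R) : v @ \oo --> k -> 1 - v n @[n --> \oo] --> 1 - k.
  by move=> vk; apply: cvgB => //; exact: cvg_cst.
have cf0 : f0 (u n) @[n --> \oo] --> f0 l.
  by apply: cvgD; apply: cvgMr => //; apply: cvgMr; exact: cB.
have cf1 : f1 (u n) @[n --> \oo] --> f1 l.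
  by apply: cvgD; apply: cvgMr => //; apply: cvgMr; exact: cB.
have W_neq0 : signed_col l (1 - l) != 0.
  apply/eqP => /matrixP h; have := h 0 0; have := h 1 0; rewrite !mxE /= => + l0.
  by rewrite l0 subr0 mulr1 /e => /eqP; rewrite sgr_eq0 (negbTE b_neq0).
have NM : N (M *m signed_col l (1 - l)) = r * N (signed_col l (1 - l)).
  have ef1 : e * f1 (u n) @[n --> \oo] --> e * f1 l by exact: cvgMr.
  have h1 := planar_norm_cvg nn_triangle nn_scale cf0 ef1.
  have h2 : r * nn (u n) (1 - u n) @[n --> \oo] --> r * nn l (1 - l).
    by apply: cvgMr; apply: (planar_norm_cvg nn_triangle nn_scale ul); exact: cB.
  by rewrite ME; apply: (lim_unique _ _ _ _ _ h1 h2) => n; rewrite /nn -Nu ME.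
have [lam Mlam] : exists lam, M *m signed_col l (1 - l) = lam *: signed_col l (1 - l).
  apply: colv2_parallel => //; rewrite ME !mxE /= !mulrA -expr2 e2 mul1r.
  have us : u n.+1 @[n --> \oo] --> l by rewrite (cvg_shiftS u).
  have h1 : f0 (u n) * (e * (1 - u n.+1)) @[n --> \oo] --> f0 l * (e * (1 - l)).
    by apply: cvgM => //; apply: cvgMr; exact: cB.
  have h2 : f1 (u n) * u n.+1 @[n --> \oo] --> f1 l * l by exact: cvgM.
  rewrite -mulrA; apply: (lim_unique _ _ _ _ _ h1 h2) => n.
  have := Mu n; rewrite ME => /matrixP h; have := h 0 0; have := h 1 0.
  rewrite !mxE /= mulrA -expr2 e2 mul1r => -> ->; ring.
exists lam; first by exists (signed_col l (1 - l)).
case: hN => -[_ sc df] _.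
have NW0 : N (signed_col l (1 - l)) != 0 by apply: contraNneq W_neq0 => /df ->.
by apply: (mulIf NW0); rewrite -NM Mlam sc.
Qed.

Lemma rational_spectral_finiteness s : is_switching_frequency A0 A1 N s ->
  rational s -> spectral_finiteness [set A0; A1].
Proof.
move=> hs rs.
have bc1 : 1 <= e * b * (e * c) by rewrite ebc.
have [t [x [y [[x0 y0] xy_gt0 xyS ext tu]]]] := monotone_extremal_orbit
  nn_triangle nn_scale nn_definite eb_gt0 ec_gt0 bc1 a_gt0 a_le1 d_gt0
  alpha_gt0 beta_gt0 rho_gt0 nn_barabanov.
(* Laws are indexed from 1 and orbits from 0. *)
pose i k := t k.-1; pose z k := signed_col (x k) (y k).
have zS k : z k.+1 = (if t k then A1 else A0) *m z k.
  have := xyS k; rewrite /z; case: (t k) => -[-> ->].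
    by rewrite mul_A1_signed_col -signed_colZ.
  by rewrite mul_A0_signed_col -signed_colZ.
have zE k : z k = switched_product A0 A1 i k *m z 0%N.
  by elim: k => [|k IH]; rewrite ?mul1mx // zS IH mulmxA.
have Nz k : N (z k) = rho ^+ k * N (z 0%N).
  by elim: k => [|k IH]; [rewrite mul1r|rewrite /z -/(nn _ _) ext /nn -/(z k) IH mulrA exprS].
have z_neq0 k : z k != 0.
  apply/eqP => /matrixP/(_ 0 0); rewrite !mxE /=; have [xk _] := xy_gt0 k.
  by apply/eqP; rewrite gt_eqF.
have := hs (z 0%N) i (z_neq0 0%N) (fun k _ => etrans (congr1 N (esym (zE k))) (Nz k)).
under eq_fun do rewrite sum_law_count_true.
rewrite /i /= => cv.
have [m [q [q0 smq]]] : exists m q, (0 < q)%N /\ s * q%:R = m%:R.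
  have s0 : 0 <= s.
    by apply: (cvgr_to_ge cv); near=> n; rewrite mulr_ge0 ?invr_ge0.
  move/rationalP: rs => [p [[|q] sE]].
    (* A zero denominator stands for [s = 0], division by zero giving zero. *)
    by exists 0%N, 1%N; rewrite sE invr0 mulr0 mul0r.
  have sq : s * q.+1%:R = p%:~R by rewrite sE divfK // pnatr_eq0.
  have p0 : 0 <= p by rewrite -(ler0z R) -sq mulr_ge0.
  by exists `|p|%N, q.+1; rewrite sq -[in LHS](gez0_abs p0).
have [K [l [tper ul]]] := rational_rotation tu cv smq q0.
set u := (fun k => _) in tu ul.
(* The product over one period, started at the time [K] from which the word is periodic. *)
pose M := switched_product A0 A1 (fun k => i (K + k)%N) q.
have hM : mx_products [set A0; A1] q M by exact: switched_product_mem.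
have Mz j : M *m z (K + j * q)%N = z (K + j.+1 * q)%N.
  rewrite mulSnr addnA [RHS]zE (switched_productD _ _ _ (K + j * q)) -mulmxA -zE; congr (_ *m _).
  apply: eq_switched_product => -[//|k] _; rewrite /i !addnS /=.
  elim: j => [|j IH]; first by rewrite mul0n addn0.
  have -> : (K + j.+1 * q + k = (K + j * q + k) + q)%N by rewrite mulSn; lia.
  by rewrite IH tper // -addnA leq_addr.
pose w k := signed_col (u k) (1 - u k).
have wz k : w k = (x k + y k)^-1 *: z k.
  have [xk yk] := xy_gt0 k.
  have xyk : x k + y k != 0 by rewrite gt_eqF ?addr_gt0.
  by rewrite -signed_colZ /w /u; congr signed_col; field.
have zw k : z k = (x k + y k) *: w k.
  have [xk yk] := xy_gt0 k.
  by rewrite wz scalerA mulfV ?scale1r // gt_eqF ?addr_gt0.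
have [_ sc df] : is_norm N by case: hN.
have [lam [v Mv v0] lamE] : exists2 lam,
    (exists2 v : 'cV[R]_2, M *m v = lam *: v & v != 0) & `|lam| = rho ^+ q.
  apply: (@limit_direction_eigenvector M (fun j => u (K + j * q)%N)
    (fun j => (x (K + j * q)%N + y (K + j * q)%N)^-1
       * (x (K + j.+1 * q)%N + y (K + j.+1 * q)%N)) l) => // j.
    by rewrite -!/(w _) wz -scalemxAr Mz zw scalerA.
  rewrite -/(w _) wz -scalemxAr Mz !sc Nz [in RHS]Nz mulSnr addnA exprD; ring.
have [[l0 [v1 Mv1 v10] srl] sr_ge] := spectral_radius_real_spectrum (disc_ge0 hM).
(* The limit eigenvector gives the lower bound. For the upper one, the eigenvalue realizing the
   spectral radius has an eigenvector [v1], whose norm grows at most by [rho ^+ q] under [M]. *)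
have srE : spectral_radius M = rho ^+ q.
  apply/eqP; rewrite eq_le -[X in _ && (X <= _)]lamE (sr_ge _ _ Mv v0) andbT srl.
  have Nv1 : 0 < N v1.
    rewrite lt_neqAle eq_sym; apply/andP; split; first by apply: contraNneq v10 => /df ->.
    by rewrite [v1]signed_colE; exact: (planar_norm_ge0 nn_triangle nn_scale).
  by rewrite -(ler_pM2r Nv1) -sc -Mv1 (mx_products_norm_le hN rho_gt0).
exists q; split => //; exists M => //.
rewrite srE -powR_mulrn ?ltW ?rho_gt0 // -powRrM mulfV ?pnatr_eq0 -?lt0n // powRr1 //.
by rewrite ltW ?rho_gt0.
Unshelve. all: by end_near.
Qed.

End SignedPair.

Unset Implicit Arguments.

Theorem theorem8 (R : realType) (a b c d alpha beta : R)
    (halpha : 0 < alpha) (hbeta : 0 < beta)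
    (hbc : 1 <= b * c) (ha1 : a <= 1) (ha0 : 0 < a) (hd : 0 < d)
    (A0 A1 : 'M[R]_2)
    (hA0 : A0 = alpha *: mx22 a b 0 1)
    (hA1 : A1 = beta *: mx22 1 0 c d)
    (N : 'cV[R]_2 -> R) (hN : Barabanov_norm A0 A1 N)
    (sigma : R) (hsigma : is_switching_frequency A0 A1 N sigma) :
  spectral_finiteness [set A0; A1] <-> rational sigma.
Proof.
subst A0 A1; split.
  exact (spectral_finiteness_rational halpha hbeta hbc ha0 hd hN hsigma).
exact (rational_spectral_finiteness halpha hbeta hbc ha1 ha0 hd hN hsigma).
Qed.
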